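(* For all integers $n\geq 0$, $$a_{1^{1}2^{-3}3^{-3}4^{2}}(2n)>0,\quad a_{1^{1}2^{-3}3^{-3}4^{2}}(6n+1)<0,\quad a_{1^{1}2^{-3}3^{-3}4^{2}}(6n+3)=0,\quad a_{1^{1}2^{-3}3^{-3}4^{2}}(6n+5)=0.$$
   Context: For $|q|<1$ (or as formal power series in $q$) let $f_j:=(q^j;q^j)_\infty=\prod_{k\ge 1}(1-q^{jk})$ for each positive integer $j$. The integers $a_{1^{1}2^{-3}3^{-3}4^{2}}(n)$, $n\ge 0$, are defined by $\sum_{n=0}^\infty a_{1^{1}2^{-3}3^{-3}4^{2}}(n)q^n=\dfrac{f_1f_4^2}{f_2^3f_3^3}$. *)

(* Defs.v *)
From mathcomp Require Import all_boot all_order all_algebra.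

Set Implicit Arguments.
Unset Strict Implicit.
Unset Printing Implicit Defensive.

Import GRing.Theory.
Local Open Scope ring_scope.

(* The formal power series \sum_n u_n q^n is encoded by its coefficients. *)
Definition fps := nat -> int.

Definition fps_one : fps := fun n => (n == 0)%N%:R.

Definition fps_mul (u v : fps) : fps :=
  fun n => \sum_(i < n.+1) u i * v (n - i)%N.

Definition fps_exp (u : fps) (m : nat) : fps := iter m (fps_mul u) fps_one.

(* The first n coefficients of 1 / u, obtained by solving u * (1 / u) = 1
   degree by degree; meaningful when u 0 is a unit (see fps_mulV). *)
Fixpoint fps_inv_prefix (u : fps) (n : nat) : seq int :=
  if n is m.+1 then
    let s := fps_inv_prefix u m in
    rcons s ((u 0%N)^-1 * (fps_one m - \sum_(i < m) s`_i * u (m - i)%N))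
  else [::].

Definition fps_inv (u : fps) : fps := fun n => (fps_inv_prefix u n.+1)`_n.

Definition fps_div (u v : fps) : fps := fps_mul u (fps_inv v).

(* f_j = \prod_(k >= 1) (1 - q^(j k)), for j >= 1: the factors with k > n do not
   affect the coefficient of q^n (see eulerf_stable). *)
Definition eulerf (j : nat) : fps :=
  fun n => (\prod_(1 <= k < n.+1) (1 - 'X^(j * k)) : {poly int})`_n.

Definition a_1p1_2m3_3m3_4p2 : fps :=
  fps_div (fps_mul (eulerf 1) (fps_exp (eulerf 4) 2))
          (fps_mul (fps_exp (eulerf 2) 3) (fps_exp (eulerf 3) 3)).

Lemma size_fps_inv_prefix u n : size (fps_inv_prefix u n) = n.
Proof. by elim: n => //= n IHn; rewrite size_rcons IHn. Qed.

Lemma nth_fps_inv_prefix u n i :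
  (i < n)%N -> (fps_inv_prefix u n)`_i = fps_inv u i.
Proof.
elim: n => // n IHn; rewrite ltnS leq_eqVlt => /predU1P[-> //|lt_in] /=.
by rewrite nth_rcons size_fps_inv_prefix lt_in IHn.
Qed.

Lemma fps_mulV (u : fps) :
  u 0%N \is a GRing.unit -> fps_mul (fps_inv u) u =1 fps_one.
Proof.
move=> u0 n; rewrite /fps_mul big_ord_recr /= subnn.
rewrite {2}/fps_inv /= nth_rcons size_fps_inv_prefix ltnn eqxx.
rewrite mulrAC mulVr // mul1r addrC.
rewrite [X in _ - X](_ : _ = \sum_(i < n) fps_inv u i * u (n - i)%N).
  by rewrite subrK.
by apply: eq_bigr => i _; rewrite nth_fps_inv_prefix.
Qed.

Lemma eulerf_stable (j n N : nat) : (0 < j)%N -> (n <= N)%N ->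
  (\prod_(1 <= k < N.+1) (1 - 'X^(j * k)) : {poly int})`_n = eulerf j n.
Proof.
move=> j0; elim: N => [|N IHN]; first by rewrite leqn0 => /eqP ->.
rewrite leq_eqVlt => /predU1P[-> //|]; rewrite ltnS => le_nN.
rewrite big_nat_recr //= mulrBr mulr1 coefB IHN // coefMXn ifT ?subr0 //.
by rewrite (leq_trans _ (leq_pmull _ j0)) // ltnS.
Qed.

Lemma eulerf0 j : eulerf j 0 = 1.
Proof. by rewrite /eulerf big_geq // coef1. Qed.

(* The defining identity: a * (f_2^3 f_3^3) = f_1 f_4^2. *)
Lemma a_1p1_2m3_3m3_4p2E :
  fps_mul a_1p1_2m3_3m3_4p2
          (fps_mul (fps_exp (eulerf 2) 3) (fps_exp (eulerf 3) 3))
  =1 fps_mul (eulerf 1) (fps_exp (eulerf 4) 2).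
Proof.
pose P n (u : fps) : {poly int} := \poly_(i < n.+1) u i.
have coefP n u i : (i <= n)%N -> (P n u)`_i = u i by move=> ?; rewrite coef_poly ltnS ifT.
have mulP n u v i : (i <= n)%N -> fps_mul u v i = (P n u * P n v)`_i.
  move=> le_in; rewrite coefM; apply: eq_bigr => k _.
  rewrite !coefP // ?(leq_trans (leq_subr _ _)) //.
  by rewrite (leq_trans _ le_in) // -ltnS.
have mulA u v w : fps_mul (fps_mul u v) w =1 fps_mul u (fps_mul v w).
  move=> n; rewrite !(mulP n) //.
  transitivity ((P n u * P n v * P n w)`_n).
    rewrite !coefM; apply: eq_bigr => k _.
    by rewrite [in LHS]coefP -1?ltnS // (mulP n) // -ltnS.
  rewrite -mulrA !coefM; apply: eq_bigr => k _; congr (_ * _).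
  by rewrite coefP ?leq_subr // (mulP n) // leq_subr.
move=> n; rewrite mulA.
set w := fps_mul (fps_exp (eulerf 2) 3) _.
have w0 : w 0%N = 1.
  by rewrite /w /fps_exp /= /fps_mul !big_ord1 /= !eulerf0.
rewrite {1}/fps_mul big_ord_recr big1 /=; last first.
  move=> i _; rewrite fps_mulV ?w0 ?unitr1 // /fps_one subn_eq0 leqNgt.
  by rewrite ltn_ord mulr0.
by rewrite add0r subnn fps_mulV ?w0 ?unitr1 // mulr1.
Qed.

(* Main.v *)
Require Import Defs.
From mathcomp Require Import all_boot all_order all_algebra.
From mathcomp Require Import zify ring.

(** Write theta(a,b) for the sum of (-1)^n q^(((a+b) n^2 + (a-b) n)/2) over all
integers n, and theta'(a,b) for the same sum without signs.  The double series
theta(1,5) theta'(3,3), split according to the parity of n + m, equals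
theta(4,8)^2 - q theta(10,2)^2, and the Jacobi triple product turns all four
thetas into quotients of the f_j.  This gives the 2-dissection
  f_1 f_4^2 / (f_2^3 f_3^3)
    = psi(q^2)^2 (f_12 / f_6)^2 / f_6^5 - q (f_12 / f_6)^6 / f_6^3
with psi(q) = theta'(1,3) = f_2^2 / f_1.  The second term only involves
exponents congruent to 1 modulo 6.  Both f_(2j) / f_j, the product of the
1 + q^(jk), and 1 / f_j have nonnegative coefficients, those of 1 / f_j being
positive at multiples of j; as psi^2 = 1 + 2q + q^2 + ... meets every residue
class modulo 3, no coefficient at an even exponent vanishes.

Everything happens modulo q^N, in a quotient of Z[q] where q is nilpotent, so
that all products and sums are finite. *)

Set Implicit Arguments.
Unset Strict Implicit.
Unset Printing Implicit Defensive.

Import Order.TTheory GRing.Theory Num.Theory.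
Local Open Scope ring_scope.

(** * Gaussian binomials and finite q-products *)

(** The Gaussian binomial coefficient in base [p], defined by the q-Pascal rule so that it exists in
    every commutative ring, without division. *)
Fixpoint gauss (R : comNzRingType) (p : R) (n j : nat) : R :=
  match n, j with
  | _, 0 => 1
  | 0, _.+1 => 0
  | n'.+1, j'.+1 => gauss p n' j' + p ^+ j * gauss p n' j
  end.

Lemma gaussn0 (R : comNzRingType) (p : R) n : gauss p n 0 = 1.
Proof. by case: n. Qed.

Lemma gaussS (R : comNzRingType) (p : R) n j :
  gauss p n.+1 j.+1 = gauss p n j + p ^+ j.+1 * gauss p n j.+1.
Proof. by []. Qed.

Lemma gauss_small (R : comNzRingType) (p : R) n j : (n < j)%N -> gauss p n j = 0.
Proof.
elim: n j => [|n IHn] [|j] //=; rewrite ltnS => lt_nj.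
by rewrite !IHn // ?mulr0 ?addr0 // ltnW.
Qed.

Lemma gaussnn (R : comNzRingType) (p : R) n : gauss p n n = 1.
Proof. by elim: n => //= n ->; rewrite gauss_small // mulr0 addr0. Qed.

Lemma rmorph_gauss (R S : comNzRingType) (f : {rmorphism R -> S}) (p : R) n j :
  f (gauss p n j) = gauss (f p) n j.
Proof.
elim: n j => [|n IHn] [|j]; rewrite /= ?rmorph0 ?rmorph1 //.
by rewrite rmorphD rmorphM rmorphXn !IHn.
Qed.

(** The q-binomial theorem. Induction on [n], for all [v]: splitting off the factor [k = 0] leaves
    the product for [v * p], and the q-Pascal rule recombines the two sums. *)
Lemma qbinomial (R : comNzRingType) (p u v : R) n :
  \prod_(k < n) (u + v * p ^+ k) =
  \sum_(j < n.+1) p ^+ 'C(j, 2) * gauss p n j * v ^+ j * u ^+ (n - j).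
Proof.
elim: n v => [|n IHn] v; first by rewrite big_ord0 big_ord1 /= !mulr1.
rewrite big_ord_recl expr0 mulr1.
under eq_bigr => i _ do rewrite lift0 exprS mulrA.
rewrite IHn mulrDl !big_distrr /=.
rewrite big_ord_recl [in RHS]big_ord_recl /= !subn0 !expr0 !gaussn0 !mulr1 !mul1r.
rewrite [X in _ + X = _]big_ord_recr /= gaussnn subnn mulr1 -addrA.
rewrite [X in _ = _ + X]big_ord_recr /= /bump !add0n !add1n.
rewrite (gauss_small _ (ltnSn n)) mulr0 addr0 gaussnn subnn !mulr1.
congr (_ + _); first by rewrite exprS.
rewrite addrA -big_split /=; congr (_ + _).
  apply: eq_bigr => i _; rewrite !add0n !add1n subSS.
  rewrite binS bin1 !exprMn !exprS -(subnSK (ltn_ord i)) !exprS exprD.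
  ring.
by rewrite binS bin1 exprMn exprS exprD; ring.
Qed.

(* The q-Pochhammer product (x^a; x^b)_M if e = true, (-x^a; x^b)_M if e = false. *)
Definition qprod (R : comNzRingType) (x : R) (e : bool) (a b M : nat) : R :=
  \prod_(k < M) (1 + (-1) ^+ e * x ^+ (a + b * k)).

Definition euler (R : comNzRingType) (x : R) (j M : nat) : R := qprod x true j j M.

Lemma rmorph_qprod (R S : comNzRingType) (f : {rmorphism R -> S}) (x : R) e a b M :
  f (qprod x e a b M) = qprod (f x) e a b M.
Proof.
rewrite rmorph_prod; apply: eq_bigr => k _.
by rewrite rmorphD rmorphM rmorph1 rmorph_sign rmorphXn.
Qed.

Lemma qprodS (R : comNzRingType) (x : R) e a b M :
  qprod x e a b M.+1 = qprod x e a b M * (1 + (-1) ^+ e * x ^+ (a + b * M)).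
Proof. exact: big_ord_recr. Qed.

(** The q-analogue of binomial(m+j, j) j! m! = (m+j)!, with [euler x s j] as q-factorial. With y =
    x^s, the q-Pascal rule reduces it to 1 - y^(m+j) = (1 - y^j) + y^j (1 - y^m). *)
Lemma gauss_fact (R : comNzRingType) (x : R) s m j :
  gauss (x ^+ s) (m + j) j * euler x s j * euler x s m = euler x s (m + j).
Proof.
have [n] := ubnP (m + j); elim: n m j => // n IHn [|m] [|j]; rewrite ltnS => le_n.
- by rewrite /euler /qprod !big_ord0 !mulr1.
- by rewrite add0n gaussnn mul1r /euler /qprod big_ord0 mulr1.
- by rewrite addn0 gaussn0 mul1r /euler /qprod big_ord0 mul1r.
have H1 := IHn m.+1 j ltac:(lia); have H2 := IHn m j.+1 ltac:(lia).
rewrite addSn in H1; rewrite addnS in H2; rewrite addnS addSn gaussS.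
rewrite [RHS]qprodS -/(euler _ _ _) mulrDl mulrDl.
transitivity (euler x s (m + j).+1 * (1 - x ^+ (s + s * j)) +
   x ^+ (s + s * j) * (euler x s (m + j).+1 * (1 - x ^+ (s + s * m)))).
  congr (_ + _).
    by rewrite -H1 [euler x s j.+1]qprodS -/(euler x s j) expr1; ring.
  rewrite -H2 [euler x s m.+1]qprodS -/(euler x s m) expr1 -!exprM mulnS; ring.
have -> : x ^+ (s + s * (m + j).+1) = x ^+ (s + s * j) * x ^+ (s + s * m).
  by rewrite -exprD; congr (_ ^+ _); lia.
ring.
Qed.

(** * Theta exponents and the finite Jacobi triple product *)

(* The exponent a n(n+1)/2 + b n(n-1)/2; the division by 2 is exact (texpE). *)
Definition texp (a b : nat) (n : int) : nat :=
  (`|((a + b)%:Z * n ^+ 2 + (a%:Z - b%:Z) * n)%R| %/ 2)%N.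

Lemma texpE a b n :
  (texp a b n)%:Z * 2 = (a + b)%:Z * n ^+ 2 + (a%:Z - b%:Z) * n.
Proof.
rewrite /texp.
(* Here t = n(n-1)/2 and t + n = n(n+1)/2; both are nonnegative, so the absolute value in [texp]
   changes nothing. *)
have [t Ht] : exists t : int, n * n = 2 * t + n.
  have [k [->|->]] : exists k : int, n = 2 * k \/ n = 2 * k + 1.
  - by exists (n %/ 2)%Z; lia.
  - by exists (2 * k * k - k); ring.
  - by exists (2 * k * k + k); ring.
have E : (a + b)%:Z * n ^+ 2 + (a%:Z - b%:Z) * n = 2 * (a%:Z * n + (a%:Z + b%:Z) * t).
  by rewrite PoszD expr2 Ht; ring.
have ge0 : 0 <= a%:Z * n + (a%:Z + b%:Z) * t.
  have -> : a%:Z * n + (a%:Z + b%:Z) * t = a%:Z * (t + n) + b%:Z * t by ring.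
  by apply: addr_ge0; apply: mulr_ge0 => //; nia.
rewrite E; lia.
Qed.

Definition tterm (R : comNzRingType) (x : R) (e : bool) (a b : nat) (n : int) : R :=
  ((-1) ^+ e) ^+ `|n|%N * x ^+ texp a b n.

(* Ramanujan's f(x^a, x^b) if e = false, f(-x^a, -x^b) if e = true, truncated to
   |n| <= K. *)
Definition theta (R : comNzRingType) (x : R) (e : bool) (a b K : nat) : R :=
  \sum_(j < K.*2.+1) tterm x e a b (j%:Z - K%:Z).

Lemma rmorph_tterm (R S : comNzRingType) (f : {rmorphism R -> S}) (x : R) e a b n :
  f (tterm x e a b n) = tterm (f x) e a b n.
Proof. by rewrite rmorphM !rmorphXn rmorphN rmorph1. Qed.

(** The q-binomial theorem with [m.*2] factors, centred at [j = m]. Both sides carry the same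
    monomial [c ^+ m * x ^+ w], whose cancellation uses that [R] is a domain and [x != 0]. *)
Lemma finite_jacobi (R : idomainType) (x : R) e a b m : x != 0 ->
  qprod x e a (a + b) m * qprod x e b (a + b) m =
  \sum_(j < m.*2.+1) gauss (x ^+ (a + b)) m.*2 j * tterm x e a b (j%:Z - m%:Z).
Proof.
move=> x0; set s := (a + b)%N; set c : R := (-1) ^+ e.
have cc : c * c = 1 by rewrite /c -signr_addb addbb.
pose w := (a * m + s * 'C(m, 2) + s * m ^ 2)%N.
(* With u = x^(s m) and v = +-x^a, the factors with k < m are monomials times
   1 +- x^(b + s (m - 1 - k)) and those with k >= m are x^(s m) times
   1 +- x^(a + s (k - m)). *)
have := @qbinomial R (x ^+ s) (x ^+ (s * m)) (c * x ^+ a) m.*2.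
have -> : \prod_(k < m.*2) (x ^+ (s * m) + c * x ^+ a * (x ^+ s) ^+ k) =
   c ^+ m * x ^+ w * (qprod x e a s m * qprod x e b s m).
  have cX : \prod_(k < m) (c * x ^+ (a + s * k)) = c ^+ m * x ^+ (a * m + s * 'C(m, 2)).
    elim: (m) => [|k IHk]; first by rewrite big_ord0 !muln0 mulr1.
    rewrite big_ord_recr /= IHk binS bin1 exprS.
    rewrite (_ : a * k.+1 + s * ('C(k, 2) + k) = a * k + s * 'C(k, 2) + (a + s * k))%N; last by lia.
    rewrite [in RHS]exprD; ring.
  have -> : c ^+ m * x ^+ w = c ^+ m * x ^+ (a * m + s * 'C(m, 2)) * (x ^+ (s * m)) ^+ m.
    by rewrite -mulrA -exprM -exprD /w; congr (_ * _ ^+ _); lia.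
  rewrite -cX -addnn big_split_ord /=.
  have -> : \prod_(i < m) (x ^+ (s * m) + c * x ^+ a * (x ^+ s) ^+ i) =
      \prod_(k < m) (c * x ^+ (a + s * k)) * qprod x e b s m.
    rewrite [qprod x e b s m](reindex_inj rev_ord_inj) /= -big_split /=.
    apply: eq_bigr => i _; rewrite mulrDr mulr1 mulrACA -/c cc mul1r -exprD.
    rewrite -mulrA -exprM -exprD addrC; congr (_ + x ^+ _).
    have := ltn_ord i; rewrite /s; nia.
  have -> : \prod_(i < m) (x ^+ (s * m) + c * x ^+ a * (x ^+ s) ^+ (m + i)) =
      (x ^+ (s * m)) ^+ m * qprod x e a s m.
    have -> : (x ^+ (s * m)) ^+ m = \prod_(i < m) x ^+ (s * m) by rewrite prodr_const card_ord.
    rewrite -big_split /=.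
    apply: eq_bigr => i _; rewrite mulrDr mulr1 -/c; congr (_ + _).
    rewrite mulrCA -exprM -mulrA -!exprD; congr (_ * _ ^+ _); lia.
  move: (_ ^+ m) (\prod_(_ < _) _) => y z; ring.
move=> H; apply: (@mulfI _ (c ^+ m * x ^+ w)).
  by rewrite mulf_neq0 // expf_neq0 // /c signr_eq0.
rewrite H big_distrr /=; apply: eq_bigr => j _.
have := ltn_ord j; move: (gauss _ _ _) => g; move: (j : nat) => {}j lt_j.
have cj : c ^+ j = c ^+ m * c ^+ `|(j%:Z - m%:Z)%R|%N.
  rewrite -exprD -[c]/((-1) ^+ e) -!exprM -[LHS]signr_odd -[RHS]signr_odd.
  congr (_ ^+ _); congr nat_of_bool; rewrite !oddM; congr (_ && _); lia.
have ej : (s * 'C(j, 2) + a * j + s * m * (m.*2 - j) = w + texp a b (j%:Z - m%:Z))%N.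
  have C2 k : (s * ('C(k, 2) * 2 + k) = s * (k * k))%N.
    by congr (_ * _)%N; elim: k => // k IHk; rewrite binS bin1; nia.
  have Hi : (s * m * (m.*2 - j) + s * m * j = s * m * (2 * m))%N.
    by rewrite -mulnDr subnK -?mul2n //; lia.
  move: (texpE a b (j%:Z - m%:Z)) (C2 j) (C2 m) Hi; rewrite expr2 /w.
  move: (texp _ _ _) (m.*2 - j)%N => t i; rewrite /s !expnS expn0 => T Cj Cm Hi.
  lia.
rewrite exprMn cj /tterm -/c; clearbody c w.
have mulE (u1 u2 u3 v w1 w2 : R) :
    u1 * v * (w1 * w2 * u2) * u3 = w1 * w2 * v * (u1 * u2 * u3) by ring.
have mulE' (v w1 w2 y z : R) : w1 * w2 * v * (y * z) = w1 * y * (v * (w2 * z)) by ring.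
by rewrite -!exprM mulE -!exprD ej !exprD mulE'.
Qed.

(** Makes the theta terms with |n| >= N vanish modulo q^N. Twice the exponent is (a-1)(n^2+n) +
    (b-1)(n^2-n) + 2n^2. *)
Lemma texp_ge a b n : (0 < a)%N -> (0 < b)%N -> (`|n| <= texp a b n)%N.
Proof.
case: a b => // a [] // b _ _; have := texpE a.+1 b.+1 n; move: (texp _ _ n) => t.
have -> : (a.+1 + b.+1)%:Z * n ^+ 2 + (a.+1%:Z - b.+1%:Z) * n =
  a%:Z * (n * n + n) + b%:Z * (n * n - n) + 2 * (n * n).
  by rewrite PoszD !intS; ring.
have h1 : 0 <= n * n + n by nia.
have h2 : 0 <= n * n - n by nia.
have h3 : `|n| <= n * n by nia.
have : 0 <= a%:Z * (n * n + n) by rewrite mulr_ge0.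
have : 0 <= b%:Z * (n * n - n) by rewrite mulr_ge0.
lia.
Qed.

(** Sorts the factors by their index modulo [d]. *)
Lemma qprod_split (R : comNzRingType) (x : R) e a b d M :
  qprod x e a b (d * M) = \prod_(i < d) qprod x e (a + b * i) (d * b) M.
Proof.
elim: M => [|M IHM].
  by rewrite muln0 /qprod big_ord0 big1 // => i _; rewrite big_ord0.
rewrite mulnSr [LHS]big_split_ord /= -[X in X * _]/(qprod x e a b (d * M)) IHM -big_split /=.
apply: eq_bigr => i _; rewrite qprodS; congr (_ * (1 + _ * x ^+ _)).
lia.
Qed.

Lemma qprod_sqr (R : comNzRingType) (x : R) a b M :
  qprod x false a b M * qprod x true a b M = qprod x true (2 * a) (2 * b) M.
Proof.
rewrite -big_split; apply: eq_bigr => k _ /=.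
have -> : (2 * a + 2 * b * k = (a + b * k) + (a + b * k))%N by lia.
by rewrite [in RHS]exprD expr0 expr1; move: (x ^+ _) => y; ring.
Qed.

Definition ints (K : nat) : seq int := [seq j%:Z - K%:Z | j <- iota 0 K.*2.+1].

Lemma ints_uniq K : uniq (ints K).
Proof. by rewrite map_inj_uniq ?iota_uniq // => i j; lia. Qed.

Lemma mem_ints K n : (n \in ints K) = (`|n| <= K)%N.
Proof.
apply/mapP/idP => [[j]|le_nK]; first by rewrite mem_iota => ? ->; lia.
by exists `|(n + K%:Z)%R|%N; rewrite ?mem_iota; lia.
Qed.

Lemma thetaE (R : comNzRingType) (x : R) e a b K :
  theta x e a b K = \sum_(n <- ints K) tterm x e a b n.
Proof. by rewrite big_map -[iota _ _]/(index_iota 0 K.*2.+1) big_mkord. Qed.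

(** The change of variables in a double theta series does not preserve the truncation box, so [h] is
    only required to match the nonzero terms. *)
Lemma reindex_support (V : nmodType) (I J : eqType) (s : seq I) (t : seq J)
    (P : pred I) (F : I -> V) (h : J -> I) :
    uniq s -> uniq t -> injective h ->
    (forall j, j \in t -> F (h j) != 0 -> (h j \in s) && P (h j)) ->
    (forall i, i \in s -> P i -> F i != 0 -> i \in map h t) ->
  \sum_(i <- s | P i) F i = \sum_(j <- t) F (h j).
Proof.
move=> us ut hI hts hst.
have nz (r : seq I) Q : \sum_(i <- r | Q i) F i = \sum_(i <- [seq i <- r | Q i & F i != 0]) F i.
  rewrite big_filter big_mkcondr; apply: eq_bigr => i _.
  by case: eqP => //= ->.
rewrite -(big_map h xpredT F) nz [RHS]nz; apply: perm_big; apply: uniq_perm.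
- exact: filter_uniq.
- by rewrite filter_uniq // map_inj_uniq.
move=> i; rewrite !mem_filter /=; apply/andP/andP.
  by case=> /andP[Pi Fi] si; split=> //; apply: hst.
by case=> Fi /mapP[j tj ij]; subst i; have /andP[-> ->] := hts j tj Fi.
Qed.

(** * Theta functions and eta quotients modulo q^N *)

Section Nilpotent.

Variables (Q : comNzRingType) (N : nat) (pi : {rmorphism {poly int} -> Q}).
Let q : Q := pi 'X.
Hypothesis qN : q ^+ N = 0.

Lemma nil_exp k : (N <= k)%N -> q ^+ k = 0.
Proof. by move=> /subnK <-; rewrite exprD qN mulr0. Qed.

Lemma tterm_eq0 e a b n :
  (0 < a)%N -> (0 < b)%N -> (N <= `|n|)%N -> tterm q e a b n = 0.
Proof.
by move=> a0 b0 le_n; rewrite /tterm nil_exp ?mulr0 // (leq_trans le_n) ?texp_ge.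
Qed.

Lemma qprod_stable e a b M : (0 < b)%N -> (N <= M)%N ->
  qprod q e a b M = qprod q e a b N.
Proof.
move=> b0; elim: M => [|M IHM]; first by rewrite leqn0 => /eqP ->.
rewrite leq_eqVlt => /predU1P[-> //|]; rewrite ltnS => le_NM.
rewrite qprodS IHM // nil_exp ?mulr0 ?addr0 ?mulr1 //.
by rewrite (leq_trans le_NM) // (leq_trans (leq_pmull M b0)) ?leq_addl.
Qed.

(* An inverse of euler x j L modulo x^L with visibly nonnegative coefficients. *)
Definition geo (R : comNzRingType) (x : R) (j L : nat) : R :=
  \prod_(k < L) \sum_(i < L) (x ^+ (j + j * k)) ^+ i.

(** Each factor telescopes: (1 - y)(1 + y + ... + y^(N-1)) = 1 - y^N, and y^N = 0 for y a positive
    power of [q]. *)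
Lemma euler_geo j : (0 < j)%N -> euler q j N * geo q j N = 1.
Proof.
move=> j0; rewrite -big_split big1 // => k _ /=.
rewrite expr1 mulN1r -opprB mulNr -subrX1 -exprM nil_exp ?sub0r ?opprK //.
by rewrite leq_pmull // addn_gt0 j0.
Qed.

(** The finite form with m = 2N, proved over the domain [{poly int}] and mapped by [pi]. Terms with
    |n| >= N vanish; for |n| < N both [j] and 4N - [j] are at least N, so by [gauss_fact] the
    Gaussian binomial is inverse to [euler q (a + b) N]. *)
Lemma jacobi e a b : (0 < a)%N -> (0 < b)%N ->
  theta q e a b N.*2 = qprod q e a (a + b) N * qprod q e b (a + b) N * euler q (a + b) N.
Proof.
move=> a0 b0; have s0 : (0 < a + b)%N by rewrite addn_gt0 a0.
have NN : (N <= N.*2)%N by lia.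
have := @finite_jacobi {poly int} 'X e a b N.*2 (negbT (polyX_eq0 _)).
move=> /(congr1 pi); rewrite rmorphM !rmorph_qprod -/q rmorph_sum /=.
rewrite !(qprod_stable _ _ s0 NN) => ->.
rewrite big_distrl /= /theta; apply: eq_bigr => j _.
rewrite rmorphM rmorph_gauss rmorph_tterm rmorphXn -/q.
set n := (_ - _ : int); have [le_n|lt_n] := leqP N `|n|%N.
  by rewrite tterm_eq0 // mulr0 mul0r.
have lt_j := ltn_ord j.
have := @gauss_fact _ q (a + b) (N.*2.*2 - j) j.
rewrite subnK; last by lia.
rewrite /euler !(qprod_stable _ _ s0) -/(euler _ _ _); try by rewrite /n in lt_n; lia.
move=> H; have E := euler_geo s0.
have {}H : gauss (q ^+ (a + b)) N.*2.*2 j * euler q (a + b) N = 1.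
  by rewrite -[LHS]mulr1 -E mulrA H.
by rewrite mulrAC H mul1r.
Qed.

Lemma theta_product :
  theta q true 1 5 N.*2 * theta q false 3 3 N.*2 =
  theta q true 4 8 N.*2 ^+ 2 - q * theta q true 10 2 N.*2 ^+ 2.
Proof.
set K := N.*2; rewrite !thetaE.
pose F p := tterm q true 1 5 p.1 * tterm q false 3 3 p.2.
have dsum (u v : int -> Q) : (\sum_(n <- ints K) u n) * (\sum_(n <- ints K) v n) =
    \sum_(p <- [seq (n, m) | n <- ints K, m <- ints K]) u p.1 * v p.2.
  by rewrite big_allpairs big_distrl; apply: eq_bigr => i _; rewrite big_distrr.
have uu : uniq [seq (n, m) | n <- ints K, m <- ints K].
  by apply: allpairs_uniq; rewrite ?ints_uniq // => -[? ?] [? ?].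
have mem p : (p \in [seq (n, m) | n <- ints K, m <- ints K]) = (`|p.1| <= K)%N && (`|p.2| <= K)%N.
  case: p => n m; rewrite -!mem_ints.
  by apply/allpairsP/andP => [[[i j] /= [? ? [-> ->]]]|[? ?]] //; exists (n, m).
have nzF p : F p != 0 -> (`|p.1| < N)%N && (`|p.2| < N)%N.
  rewrite !ltnNge => nz; apply/andP; split; apply: contraNN nz => le; rewrite /F.
    by rewrite tterm_eq0 ?mul0r.
  by rewrite [X in _ * X]tterm_eq0 ?mulr0.
have sgn (k l : nat) : odd k = odd l -> (-1) ^+ k = (-1) ^+ l :> Q.
  by move=> kl; rewrite -signr_odd kl signr_odd.
(* Substitute (n, m) = (r + s, r - s) when n + m is even and
   (n, m) = (r + s + 1, r - s) when it is odd. *)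
rewrite !expr2 !dsum (bigID (fun p : int * int => (2 %| p.1 + p.2)%Z)) /=; congr (_ + _).
  rewrite (@reindex_support _ _ _ _ _ _ F (fun p => (p.1 + p.2, p.1 - p.2)) uu uu).
  - apply: eq_bigr => -[r s] _; rewrite /F /tterm /= !expr1 expr0 expr1n mul1r.
    rewrite -mulrA -exprD [RHS]mulrACA -!exprD; congr (_ * q ^+ _).
      by apply: sgn; lia.
    (* The cross terms cancel: 3(r+s)^2 - 2(r+s) + 3(r-s)^2 = (6r^2 - 2r) + (6s^2 - 2s). *)
    have := texpE 1 5 (r + s); have := texpE 3 3 (r - s).
    have := texpE 4 8 r; have := texpE 4 8 s; rewrite !expr2; lia.
  - by move=> [r s] [r' s'] /= []; move=> *; congr (_, _); lia.
  - by move=> [r s]; rewrite !mem => _ /nzF /=; lia.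
  move=> [n m]; rewrite mem => _ Pnm /nzF lt; rewrite /= in Pnm lt.
  have [r Hr] : exists r : int, n + m = 2 * r by exists ((n + m) %/ 2)%Z; lia.
  by apply/mapP; exists (r, r - m); rewrite ?mem /=; [lia | congr (_, _); lia].
rewrite big_distrr -sumrN.
rewrite (@reindex_support _ _ _ _ _ _ F (fun p => (p.1 + p.2 + 1, p.1 - p.2)) uu uu).
- apply: eq_bigr => -[r s] _; rewrite /F /tterm /= !expr1 expr0 expr1n mul1r.
  rewrite -mulrA -exprD [X in - (q * X)]mulrACA -!exprD mulrCA -exprS -mulNr.
  congr (_ * q ^+ _).
    by rewrite -[RHS]mulN1r -exprS; apply: sgn; lia.
  (* Now the exponent is (6r^2 + 4r) + (6s^2 + 4s) + 1, the final 1 being the factor [q]. *)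
  have := texpE 1 5 (r + s + 1); have := texpE 3 3 (r - s).
  have := texpE 10 2 r; have := texpE 10 2 s; rewrite !expr2; lia.
- by move=> [r s] [r' s'] /= []; move=> *; congr (_, _); lia.
- by move=> [r s]; rewrite !mem => _ /nzF /=; lia.
move=> [n m]; rewrite mem => _ Pnm /nzF lt; rewrite /= in Pnm lt.
have [r Hr] : exists r : int, n + m = 2 * r + 1 by exists ((n + m) %/ 2)%Z; lia.
by apply/mapP; exists (r, r - m); rewrite ?mem /=; [lia | congr (_, _); lia].
Qed.

Lemma qprod_dissect d e a b : (0 < d)%N -> (0 < b)%N ->
  qprod q e a b N = \prod_(i < d) qprod q e (a + b * i) (d * b) N.
Proof.
move=> d0 b0; rewrite -qprod_split.
by rewrite (qprod_stable e a b0 (leq_pmull N d0)).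
Qed.

Lemma qprod2 e a b : (0 < b)%N ->
  qprod q e a b N = qprod q e a (2 * b) N * qprod q e (a + b) (2 * b) N.
Proof.
move=> b0; rewrite (@qprod_dissect 2) // !big_ord_recl big_ord0 mulr1.
by rewrite muln0 addn0 muln1.
Qed.

Lemma qprod3 e a b : (0 < b)%N ->
  qprod q e a b N = qprod q e a (3 * b) N * qprod q e (a + b) (3 * b) N *
    qprod q e (a + 2 * b) (3 * b) N.
Proof.
move=> b0; rewrite (@qprod_dissect 3) // !big_ord_recl big_ord0 mulr1 mulrA.
by rewrite muln0 addn0 muln1 (mulnC 2).
Qed.

Notation E j := (euler q j N).

Lemma euler2 j : (0 < j)%N -> E j = qprod q true j (2 * j) N * E (2 * j).
Proof. by move=> j0; rewrite /euler qprod2 // addnn -mul2n. Qed.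

(** The odd multiples of j split modulo 6j into the classes j, 3j, 5j: the first and last form the
    theta function, the middle one is f_(3j) / f_(6j). *)
Lemma euler_theta_1_5 j : (0 < j)%N ->
  E j * E (6 * j) ^+ 2 = theta q true j (5 * j) N.*2 * (E (2 * j) * E (3 * j)).
Proof.
move=> j0; rewrite jacobi ?muln_gt0 // (euler2 j0) (@euler2 (3 * j)) ?muln_gt0 //.
rewrite (@qprod3 _ j (2 * j)) ?muln_gt0 //.
have -> : (3 * (2 * j) = 6 * j)%N by lia.
have -> : (2 * (3 * j) = 6 * j)%N by lia.
have -> : (j + 2 * j = 3 * j)%N by lia.
have -> : (j + 2 * (2 * j) = 5 * j)%N by lia.
have -> : (j + 5 * j = 6 * j)%N by lia.
ring.
Qed.

(** Ramanujan's phi(q^j): [qprod_sqr] turns the plus signs of the triple product into Euler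
    products. *)
Lemma theta_1_1 j : (0 < j)%N ->
  theta q false j j N.*2 * (E j ^+ 2 * E (4 * j) ^+ 2) = E (2 * j) ^+ 5.
Proof.
move=> j0; rewrite jacobi // addnn -mul2n (euler2 j0).
have e2 : E (2 * j) = qprod q true (2 * j) (4 * j) N * E (4 * j).
  by rewrite euler2 ?muln_gt0 // mulnA.
have p2 := qprod_sqr q j (2 * j) N; rewrite mulnA in p2; rewrite e2 -p2; ring.
Qed.

Lemma theta_1_3 j : (0 < j)%N -> theta q false j (3 * j) N.*2 * E j = E (2 * j) ^+ 2.
Proof.
move=> j0; rewrite jacobi ?muln_gt0 //.
have e2 : E (2 * j) = qprod q true (2 * j) (4 * j) N * E (4 * j).
  by rewrite euler2 ?muln_gt0 // mulnA.
have p2 := qprod_sqr q j (2 * j) N; rewrite (@qprod2 false) ?muln_gt0 // in p2.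
have e4 : (2 * (2 * j) = 4 * j)%N by lia.
have e3 : (j + 2 * j = 3 * j)%N by lia.
have -> : (j + 3 * j = 4 * j)%N by lia.
rewrite e4 e3 in p2; rewrite (euler2 j0) expr2 {2}e2 -p2; ring.
Qed.

(** Euler's pentagonal number theorem: the three residue classes modulo 3 reassemble f_j. *)
Lemma theta_1_2 j : (0 < j)%N -> theta q true j (2 * j) N.*2 = E j.
Proof.
move=> j0; rewrite jacobi ?muln_gt0 // [E j]qprod3 //.
have -> : (j + 2 * j = 3 * j)%N by lia.
by rewrite addnn -mul2n.
Qed.

Lemma qprod_distinct j : (0 < j)%N -> qprod q false j j N * E j = E (2 * j).
Proof. by move=> j0; apply: qprod_sqr. Qed.

Lemma dissection :
  E 1 * E 4 ^+ 2 * geo q 2 N ^+ 3 * geo q 3 N ^+ 3 =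
  theta q false 2 6 N.*2 ^+ 2 * qprod q false 6 6 N ^+ 2 * geo q 6 N ^+ 5 -
  q * (qprod q false 6 6 N ^+ 6 * geo q 6 N ^+ 3).
Proof.
have h0 := theta_product; rewrite (theta_1_2 (isT : 0 < 4)%N) in h0.
have -> : theta q false 2 6 N.*2 = E 4 ^+ 2 * geo q 2 N.
  rewrite -[LHS]mulr1 -(euler_geo (isT : 0 < 2)%N) mulrA.
  by congr (_ * _); apply: (theta_1_3 (isT : 0 < 2)%N).
have -> : qprod q false 6 6 N = E 12 * geo q 6 N.
  rewrite -[LHS]mulr1 -(euler_geo (isT : 0 < 6)%N) mulrA.
  by congr (_ * _); apply: (qprod_distinct (isT : 0 < 6)%N).
have sym : theta q true 10 2 N.*2 = theta q true 2 10 N.*2.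
  by rewrite !jacobi // mulrAC [X in _ = X * _]mulrC mulrAC.
rewrite sym {sym} in h0.
have h1 : E 1 * E 6 ^+ 2 = theta q true 1 5 N.*2 * (E 2 * E 3) := @euler_theta_1_5 1 isT.
have h2 : E 2 * E 12 ^+ 2 = theta q true 2 10 N.*2 * (E 4 * E 6) := @euler_theta_1_5 2 isT.
have h3 : theta q false 3 3 N.*2 * (E 3 ^+ 2 * E 12 ^+ 2) = E 6 ^+ 5 := @theta_1_1 3 isT.
have := euler_geo (isT : 0 < 2)%N; have := euler_geo (isT : 0 < 3)%N.
have := euler_geo (isT : 0 < 4)%N; have := euler_geo (isT : 0 < 6)%N.
move: (theta q true 1 5 _) (theta q false 3 3 _) (theta q true 2 10 _) h0 h1 h2 h3.
move: (E 1) (E 2) (E 3) (E 4) (E 6) (E 12) => e1 e2 e3 e4 e6 e12.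
move: (geo q 2 N) (geo q 3 N) (geo q 4 N) (geo q 6 N) => g2 g3 g4 g6 t1 t2 t3.
move=> h0 h1 h2 h3 u6 u4 u3 u2.
have {}h1 : e1 = t1 * e2 * e3 * g6 ^+ 2.
  transitivity (e1 * e6 ^+ 2 * g6 ^+ 2); last by rewrite h1; ring.
  by rewrite -mulrA -exprMn u6 expr1n mulr1.
have {}h2 : t3 = e2 * e12 ^+ 2 * g4 * g6.
  transitivity (t3 * (e4 * e6) * g4 * g6); last by rewrite -h2; ring.
  by rewrite -!mulrA (mulrCA e6) u6 mulr1 u4 mulr1.
have {}h0 : t1 * e6 ^+ 5 = (e4 ^+ 2 - q * t3 ^+ 2) * (e3 ^+ 2 * e12 ^+ 2).
  by rewrite -h3 -h0; ring.
have {}h3 : t1 = (e4 ^+ 2 - q * t3 ^+ 2) * (e3 ^+ 2 * e12 ^+ 2) * g6 ^+ 5.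
  by rewrite -h0 -mulrA -exprMn u6 expr1n mulr1.
rewrite h1 h3 h2.
(* Grouped so that the surplus factors appear as products [e2 * g2], [e3 * g3], [e4 * g4], all equal
   to 1. *)
transitivity (e4 ^+ 4 * e12 ^+ 2 * g6 ^+ 7 * g2 ^+ 2 * (e2 * g2) * (e3 * g3) ^+ 3 -
   q * e12 ^+ 6 * g6 ^+ 9 * (e2 * g2) ^+ 3 * (e3 * g3) ^+ 3 * (e4 * g4) ^+ 2); first by ring.
by rewrite u2 u3 u4 !expr1n; ring.
Qed.

End Nilpotent.

(** * Transfer to coefficients of power series *)

Lemma rmorph_theta (R S : comNzRingType) (f : {rmorphism R -> S}) (x : R) e a b K :
  f (theta x e a b K) = theta (f x) e a b K.
Proof. by rewrite rmorph_sum; apply: eq_bigr => j _; rewrite rmorph_tterm. Qed.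

Lemma rmorph_geo (R S : comNzRingType) (f : {rmorphism R -> S}) (x : R) j L :
  f (geo x j L) = geo (f x) j L.
Proof.
rewrite rmorph_prod; apply: eq_bigr => k _; rewrite rmorph_sum.
by apply: eq_bigr => i _; rewrite !rmorphXn.
Qed.

Lemma thetaXn (R : comNzRingType) (x : R) d e a b K :
  theta (x ^+ d) e a b K = theta x e (d * a) (d * b) K.
Proof.
apply: eq_bigr => j _; rewrite /tterm -[(x ^+ d) ^+ _]exprM; congr (_ * x ^+ _).
move: (_ - _ : int) => n; have := texpE a b n; have := texpE (d * a) (d * b) n.
rewrite -mulnDr !PoszM; nia.
Qed.

Lemma qprodXn (R : comNzRingType) (x : R) d e a b M :
  qprod (x ^+ d) e a b M = qprod x e (d * a) (d * b) M.
Proof. by apply: eq_bigr => k _; rewrite -exprM mulnDr mulnA. Qed.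

Lemma geoXn (R : comNzRingType) (x : R) d j L : geo (x ^+ d) j L = geo x (d * j) L.
Proof.
apply: eq_bigr => k _; apply: eq_bigr => i _.
by rewrite -[x ^+ d ^+ _]exprM mulnDr mulnA.
Qed.

Lemma truncation (R : comNzRingType) (N : nat) : (0 < N)%N ->
  exists (Q : comNzRingType) (pi : {rmorphism {poly R} -> Q}),
    forall p r, pi p = pi r <-> (forall i, (i < N)%N -> p`_i = r`_i).
Proof.
move=> N0; exists {poly %/ 'X^N}, (in_qpoly 'X^N) => p r.
have inE (s : {poly R}) : in_qpoly 'X^N s = take_poly N s :> {poly R}.
  (* [mk_monic 'X^N] is ['X^(N.-1.+1)], which is ['X^N] because N > 0. *)
  rewrite /= mk_monic_Xn prednK // -{1}(poly_take_drop N s) addrC.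
  rewrite (Pdiv.RingMonic.rmodp_addl_mul_small (monicXn _ N)) //.
  by rewrite size_polyXn ltnS size_take_poly.
split=> [/(congr1 (@polyn _ _)) | eq_pr].
  rewrite !inE => eq_pr i lt_iN.
  by move: (congr1 (fun s : {poly R} => s`_i) eq_pr); rewrite !coef_take_poly lt_iN.
apply: val_inj; rewrite [val _]inE [val _]inE.
by apply/polyP => i; rewrite !coef_take_poly; case: ifP => // /eq_pr.
Qed.

Lemma eulerE (R : comNzRingType) (x : R) j M :
  euler x j M = \prod_(1 <= k < M.+1) (1 - x ^+ (j * k)).
Proof.
rewrite big_add1 big_mkord; apply: eq_bigr => k _.
by rewrite expr1 mulN1r mulnS.
Qed.

(** The first term of the 2-dissection, with q^2 renamed to q. *)
Definition even_part (N : nat) : {poly int} :=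
  theta 'X false 1 3 N.*2 ^+ 2 * qprod 'X false 3 3 N ^+ 2 * geo 'X 3 N ^+ 5.

(** The second term without its factor -q, with q^6 renamed to q. *)
Definition odd_part (N : nat) : {poly int} :=
  qprod 'X false 1 1 N ^+ 6 * geo 'X 1 N ^+ 3.

Lemma coef_dissection (N n : nat) : (n < N)%N ->
  a_1p1_2m3_3m3_4p2 n = (even_part N \Po 'X^2 - 'X * (odd_part N \Po 'X^6))`_n.
Proof.
move=> lt_nN; have N0 : (0 < N)%N by apply: leq_trans lt_nN.
have [Q [pi piP]] := @truncation int N N0.
have qN : pi 'X ^+ N = 0.
  rewrite -rmorphXn -(rmorph0 pi); apply/piP => i lt_iN.
  by rewrite coefXn coef0 ltn_eqF.
(* Truncation followed by [pi] respects products, so the defining identity of the series passes to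
   the quotient. *)
pose P (u : fps) : {poly int} := \poly_(i < N) u i.
have PE u i : (i < N)%N -> (P u)`_i = u i by rewrite coef_poly => ->.
have piM u v : pi (P (fps_mul u v)) = pi (P u) * pi (P v).
  rewrite -rmorphM; apply/piP => i lt_iN; rewrite PE // coefM; apply: eq_bigr => k _.
  by have lt_k := ltn_ord k; rewrite !PE //; lia.
have piX u m : pi (P (fps_exp u m)) = pi (P u) ^+ m.
  elim: m => [|m IHm]; last by rewrite exprS -IHm -piM.
  rewrite expr0 -(rmorph1 pi); apply/piP => i lt_iN.
  by rewrite PE // coef1.
have piE j : (0 < j)%N -> pi (P (eulerf j)) = euler (pi 'X) j N.
  move=> j0; rewrite /euler -rmorph_qprod -/(euler _ _ _) eulerE; apply/piP => i lt_iN.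
  by rewrite PE // eulerf_stable // ltnW.
have D := dissection qN.
have Ea : pi (P a_1p1_2m3_3m3_4p2) * (euler (pi 'X) 2 N ^+ 3 * euler (pi 'X) 3 N ^+ 3)
   = euler (pi 'X) 1 N * euler (pi 'X) 4 N ^+ 2.
  rewrite -!piE // -!piX -!piM; apply/piP => i lt_iN.
  by rewrite !PE // a_1p1_2m3_3m3_4p2E.
rewrite -(PE _ _ lt_nN); move: n lt_nN; apply/piP.
rewrite rmorphB [pi (_ * _)]rmorphM.
have even_partE (S : comNzRingType) (f : {rmorphism {poly int} -> S}) : f (even_part N) =
    theta (f 'X) false 1 3 N.*2 ^+ 2 * qprod (f 'X) false 3 3 N ^+ 2 * geo (f 'X) 3 N ^+ 5.
  by rewrite 2!rmorphM !rmorphXn rmorph_theta rmorph_qprod rmorph_geo.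
have odd_partE (S : comNzRingType) (f : {rmorphism {poly int} -> S}) : f (odd_part N) =
    qprod (f 'X) false 1 1 N ^+ 6 * geo (f 'X) 1 N ^+ 3.
  by rewrite rmorphM !rmorphXn rmorph_qprod rmorph_geo.
(* Substitution followed by [pi] is read as one ring morphism sending ['X] to a power of [pi 'X]. *)
rewrite -[pi (even_part N \Po _)]/((pi \o comp_poly 'X^2) (even_part N)) even_partE.
rewrite -[pi (odd_part N \Po _)]/((pi \o comp_poly 'X^6) (odd_part N)) odd_partE.
rewrite /= !comp_polyX !rmorphXn thetaXn !qprodXn !geoXn.
rewrite -D -Ea; have u2 := euler_geo qN (isT : 0 < 2)%N; have u3 := euler_geo qN (isT : 0 < 3)%N.
transitivity (pi (P a_1p1_2m3_3m3_4p2) * (euler (pi 'X) 2 N * geo (pi 'X) 2 N) ^+ 3 *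
    (euler (pi 'X) 3 N * geo (pi 'X) 3 N) ^+ 3).
  by rewrite u2 u3 !expr1n !mulr1.
ring.
Qed.

(** * Positivity of the two parts *)

Definition nneg (p : {poly int}) := forall i, 0 <= p`_i.

Lemma nnegM p r : nneg p -> nneg r -> nneg (p * r).
Proof. by move=> p0 r0 i; rewrite coefM sumr_ge0 // => k _; rewrite mulr_ge0. Qed.

Lemma coefM_gt0 p r i j : nneg p -> nneg r -> 0 < p`_i -> 0 < r`_j -> 0 < (p * r)`_(i + j).
Proof.
move=> p0 r0 pi rj; rewrite coefM.
have lt_i : (i < (i + j).+1)%N by rewrite ltnS leq_addr.
rewrite (bigD1 (Ordinal lt_i)) //= addKn ltr_pwDl ?mulr_gt0 //.
by rewrite sumr_ge0 // => k _; rewrite mulr_ge0.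
Qed.

(** Multiplication by such a factor keeps the positive coefficients of a nonnegative polynomial
    positive. *)
Definition nneg1 (p : {poly int}) := nneg p /\ 0 < p`_0.

Lemma nneg1M p r : nneg1 p -> nneg1 r -> nneg1 (p * r).
Proof.
move=> [p0 p1] [r0 r1]; split; first exact: nnegM.
by rewrite -[0%N]addn0; apply: coefM_gt0.
Qed.

Lemma nneg1_1 : nneg1 1.
Proof. by split=> [i|]; rewrite coef1. Qed.

Lemma nneg1X p n : nneg1 p -> nneg1 (p ^+ n).
Proof. by move=> p1; elim: n => [|n IHn]; rewrite ?exprS; [apply: nneg1_1|apply: nneg1M]. Qed.

Lemma nneg1_qprod a b M : (0 < a)%N -> nneg1 (qprod 'X false a b M).
Proof.
move=> a0; apply: (big_ind nneg1 nneg1_1 nneg1M) => k _; rewrite expr0 mul1r.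
split=> [i|]; rewrite coefD coef1 coefXn ?addr_ge0 //.
by case: eqP => //; lia.
Qed.

Lemma nneg_sumXn (I : Type) (s : seq I) (P : pred I) (F : I -> nat) :
  nneg (\sum_(i <- s | P i) 'X^(F i)).
Proof. by move=> i; rewrite coef_sum sumr_ge0 // => k _; rewrite coefXn. Qed.

Lemma coef_sumXn_gt0 (I : finType) (F : I -> nat) i : 0 < (\sum_i 'X^(F i) : {poly int})`_(F i).
Proof.
rewrite coef_sum (bigD1 i) //= coefXn eqxx ltr_pwDl // sumr_ge0 // => k _.
by rewrite coefXn.
Qed.

Lemma nneg1_geo j L : nneg1 (geo 'X j L).
Proof.
case: L => [|L]; first by rewrite /geo big_ord0; apply: nneg1_1.
apply: (big_ind nneg1 nneg1_1 nneg1M) => k _.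
under eq_bigr => i _ do rewrite -exprM.
split; first exact: nneg_sumXn.
by have := @coef_sumXn_gt0 'I_L.+1 (fun i => (j + j * k) * i)%N ord0; rewrite muln0.
Qed.

(** The factor [k = 0] contains q^(jn); every other factor contributes its constant term. *)
Lemma coef_geo_gt0 j L n : (n < L)%N -> 0 < (geo 'X j L : {poly int})`_(j * n).
Proof.
case: L => // L lt_n; rewrite /geo big_ord_recl -[(j * n)%N]addn0.
have H k : nneg1 (\sum_(i < L.+1) ('X^(j + j * k)) ^+ i).
  under eq_bigr => i _ do rewrite -exprM.
  split; first exact: nneg_sumXn.
  by have := @coef_sumXn_gt0 'I_L.+1 (fun i => (j + j * k) * i)%N ord0; rewrite muln0.
have [p0 p1] : nneg1 (\prod_(i < L) \sum_(i0 < L.+1) ('X^(j + j * lift ord0 i)) ^+ i0).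
  by apply: (big_ind nneg1 nneg1_1 nneg1M) => k _; apply: H.
apply: coefM_gt0 => //; first by case: (H (@ord0 L)).
under eq_bigr => i _ do rewrite -exprM.
have := @coef_sumXn_gt0 'I_L.+1 (fun i => (j + j * @ord0 L) * i)%N (Ordinal lt_n).
by rewrite /= muln0 addn0.
Qed.

Lemma odd_part_gt0 N n : (n < N)%N -> 0 < (odd_part N)`_n.
Proof.
move=> lt_n; rewrite /odd_part exprS mulrCA -[n in X in 0 < X]addn0.
have [d0 d1] := @nneg1M _ _ (nneg1X 6 (nneg1_qprod 1 N (isT : 0 < 1)%N)) (nneg1X 2 (nneg1_geo 1 N)).
apply: coefM_gt0 => //; first by case: (nneg1_geo 1 N).
by rewrite -(mul1n n); apply: coef_geo_gt0.
Qed.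

Lemma even_part_gt0 N n : (n < N)%N -> 0 < (even_part N)`_n.
Proof.
move=> lt_n.
have th : theta 'X false 1 3 N.*2 =
    \sum_(j < N.*2.*2.+1) 'X^(texp 1 3 (j%:Z - N.*2%:Z)) :> {poly int}.
  by apply: eq_bigr => j _; rewrite /tterm expr1n mul1r.
pose psi : {poly int} := theta 'X false 1 3 N.*2.
have psi0 : nneg psi by rewrite /psi th; apply: nneg_sumXn.
have psiT (k : nat) m : (k <= N.*2)%N -> texp 1 3 k = m -> 0 < psi`_m.
  move=> le_k <-; have lt_k : (k + N.*2 < N.*2.*2.+1)%N by lia.
  rewrite /psi th.
  have := coef_sumXn_gt0 (fun j : 'I_(N.*2.*2.+1) => texp 1 3 (j%:Z - N.*2%:Z)) (Ordinal lt_k).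
  by rewrite /= (_ : (k + N.*2)%N%:Z - N.*2%:Z = k) //; lia.
(* The indices 0 and 1 give the exponents 0 and 1 in psi, whose pairwise sums 0, 1, 2 cover all
   residues modulo 3. *)
have psi_0 : 0 < psi`_0 by apply: (psiT 0%N).
have psi_1 : 0 < psi`_1 by apply: (psiT 1%N) => //; lia.
have sq r : (r < 3)%N -> 0 < (psi ^+ 2)`_r.
  rewrite expr2; case: r => [|[|[|]]] // _.
  - exact: (@coefM_gt0 _ _ 0 0).
  - exact: (@coefM_gt0 _ _ 0 1).
  - exact: (@coefM_gt0 _ _ 1 1).
have [d0 d1] := @nneg1M _ _ (nneg1X 2 (nneg1_qprod 3 N (isT : 0 < 3)%N)) (nneg1X 4 (nneg1_geo 3 N)).
have -> : even_part N =
    psi ^+ 2 * geo 'X 3 N * (qprod 'X false 3 3 N ^+ 2 * geo 'X 3 N ^+ 4).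
  by rewrite /even_part [geo _ _ _ ^+ 5]exprS mulrACA mulrA.
(* Degree [n %% 3] comes from psi^2, degree [3 * (n %/ 3)] from one factor 1/f_3, and degree 0 from
   the rest. *)
have -> : n = (n %% 3 + 3 * (n %/ 3) + 0)%N by rewrite [in LHS](divn_eq n 3); lia.
have [g0 _] := nneg1_geo 3 N.
apply: coefM_gt0 => //; first by do !apply: nnegM.
apply: coefM_gt0 => //; first exact: nnegM.
  by apply: sq; rewrite ltn_mod.
by apply: coef_geo_gt0; apply: leq_ltn_trans lt_n; apply: leq_div.
Qed.

Theorem theorem6p2 : forall n : nat,
  [/\ 0 < a_1p1_2m3_3m3_4p2 (2 * n)%N,
      a_1p1_2m3_3m3_4p2 (6 * n + 1)%N < 0,
      a_1p1_2m3_3m3_4p2 (6 * n + 3)%N = 0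
    & a_1p1_2m3_3m3_4p2 (6 * n + 5)%N = 0].
Proof.
(* This precision exceeds all four exponents. *)
move=> n; pose N := (6 * n + 6)%N.
(* Even exponents see only [even_part], those congruent to 1 modulo 6 only [odd_part], and the
   remaining ones neither. *)
have cE i : (i < N)%N -> a_1p1_2m3_3m3_4p2 i =
    (if (2 %| i)%N then (even_part N)`_(i %/ 2) else 0) -
    (if (0 < i)%N && (6 %| i.-1)%N then (odd_part N)`_(i.-1 %/ 6) else 0).
  move=> lt_i; rewrite (coef_dissection lt_i) coefB coefXM !coef_comp_poly_Xn //.
  by case: i lt_i.
rewrite !cE; try by rewrite /N; lia.
have -> : ((0 < 2 * n) && (6 %| (2 * n).-1))%N = false by lia.
have -> : (2 %| 6 * n + 1)%N = false by lia.
have -> : (2 %| 6 * n + 3)%N = false by lia.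
have -> : (2 %| 6 * n + 5)%N = false by lia.
have -> : ((0 < 6 * n + 3) && (6 %| (6 * n + 3).-1))%N = false by lia.
have -> : ((0 < 6 * n + 5) && (6 %| (6 * n + 5).-1))%N = false by lia.
rewrite addn1 /= !dvdn_mulr // !mulKn // !subr0 sub0r oppr_lt0.
by split=> //; [apply: even_part_gt0 | apply: odd_part_gt0]; rewrite /N; lia.
Qed.
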